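(* Let $N,M\ge 1$ be integers, let $\mathscr{A}$ be a finite set of real $(N\times M)$-matrices and let $\mathscr{B}$ be a finite set of real $(M\times N)$-matrices such that for all $A=(a_{ij})\in\mathscr{A}$ and $B=(b_{ij})\in\mathscr{B}$ all entries are nonnegative, $$a_{ij}\ge 0,\qquad b_{ij}\ge 0\qquad\text{for all } i,j,$$ and no row is zero, $$\min_i\sum_j a_{ij}>0,\qquad \min_i\sum_j b_{ij}>0.$$ Suppose that every sequence $\{A_n\}\in\mathscr{A}^{\infty}$ is $\mathscr{B}$-right-bounded. Then there exists a constant $C>0$ such that for every sequence $\{A_n\}\in\mathscr{A}^{\infty}$ there is a sequence $\{B_n\}\in\mathscr{B}^{\infty}$ with $$\|A_nB_n\cdots A_1B_1\|\le C\qquad\text{for all } n=1,2,\ldots.$$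
   Context: For a set of matrices $\mathscr{M}$, $\mathscr{M}^{\infty}$ denotes the set of infinite sequences $\{M_i\}_{i\ge1}$ with $M_i\in\mathscr{M}$. $\|\cdot\|$ denotes a fixed norm on the space of real $(N\times N)$-matrices (all such norms are equivalent, so the choice is immaterial). A sequence $\{A_n\}\in\mathscr{A}^{\infty}$ is called $\mathscr{B}$-right-bounded if there exist a sequence $\{B_n\}\in\mathscr{B}^{\infty}$ and a constant $C'$ (both possibly depending on $\{A_n\}$) such that $\|A_nB_n\cdots A_1B_1\|\le C'$ for all $n=1,2,\ldots$. *)

(* Defs.v *)
From HB Require Import structures.
From mathcomp Require Import all_boot all_order all_algebra.
From mathcomp Require Import all_classical all_reals.

Set Implicit Arguments.
Unset Strict Implicit.
Unset Printing Implicit Defensive.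

Import Order.TTheory GRing.Theory Num.Theory.

Local Open Scope classical_set_scope.
Local Open Scope ring_scope.

(* The axioms of the factory [Lmodule_isNormed], as a predicate on a function,
   so as to range over all norms on a space; nonnegativity follows. *)
Definition is_norm (R : realType) (V : lmodType R) (nu : V -> R) : Prop :=
  [/\ forall x y, nu (x + y) <= nu x + nu y,
      forall (a : R) x, nu (a *: x) = `|a| * nu x
    & forall x, nu x = 0 -> x = 0].

(* Sequences are indexed from 0: [u k] is the term of index [k + 1]. *)
Definition seqs_in (T : Type) (S : set T) : set (nat -> T) :=
  [set u | forall k, S (u k)].

(* [altprod A B n] is the product A_n B_n ... A_1 B_1 of the first [n] pairs. *)
Fixpoint altprod (R : realType) (N M : nat)
    (A : nat -> 'M[R]_(N, M)) (B : nat -> 'M[R]_(M, N)) (n : nat) : 'M[R]_N :=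
  if n is k.+1 then A k *m B k *m altprod A B k else 1%:M.

Definition right_bounded (R : realType) (N M : nat) (nu : 'M[R]_N -> R)
    (BB : set 'M[R]_(M, N)) (A : nat -> 'M[R]_(N, M)) : Prop :=
  exists B : nat -> 'M[R]_(M, N), exists C : R,
    seqs_in BB B /\ forall n, (0 < n)%N -> nu (altprod A B n) <= C.

Definition nonneg_mx (R : realType) (m n : nat) (X : 'M[R]_(m, n)) : Prop :=
  forall i j, 0 <= X i j.

(* For [0 < m] this is min_i \sum_j x_ij > 0. *)
Definition pos_row_sums (R : realType) (m n : nat) (X : 'M[R]_(m, n)) : Prop :=
  forall i, 0 < \sum_j X i j.

(* Main.v *)
(* Let [F c] be the set of sequences [A] admitting, for every [n], some [B] whose
   products of lengths at most [n] are bounded by [c].  The sets [F c] are closed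
   and cover all sequences, so by the Baire category theorem some [F c] contains
   every sequence that starts with a certain finite word [w].  Given any [A],
   apply this to the word [w] followed by [A]: its long products are [Q W], where
   [W] comes from [w] and [Q] from [A].  The row sums of [W] are bounded below by
   some [d > 0] depending only on the length of [w], and [Q] is nonnegative, so
   a bound on [Q W] bounds [Q] uniformly in [A].  Koenig's lemma (the set of the
   [B]'s is finite) then yields one [B] that works for all lengths. *)
Require Import Defs.
From HB Require Import structures.
From mathcomp Require Import all_boot all_order all_algebra.
From mathcomp Require Import all_classical all_reals all_analysis.

Import Order.TTheory GRing.Theory Num.Theory.
Import numFieldNormedType.Exports.

Local Open Scope classical_set_scope.
Local Open Scope ring_scope.

(** * Comparison of an arbitrary norm with the entries of a matrix *)

Lemma is_norm0 {R : realType} {V : lmodType R} {nu : V -> R} :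
  is_norm nu -> nu 0 = 0.
Proof. by case=> _ nuZ _; rewrite -(scale0r 0) nuZ normr0 mul0r. Qed.

Lemma is_normN {R : realType} {V : lmodType R} {nu : V -> R} (x : V) :
  is_norm nu -> nu (- x) = nu x.
Proof. by case=> _ nuZ _; rewrite -scaleN1r nuZ normrN1 mul1r. Qed.

Lemma is_norm_ge0 {R : realType} {V : lmodType R} {nu : V -> R} (x : V) :
  is_norm nu -> 0 <= nu x.
Proof.
move=> nunu; have [nuD _ _] := nunu.
have := nuD x (- x); rewrite subrr is_norm0 // is_normN // -mulr2n.
by rewrite pmulrn_lge0.
Qed.

Lemma is_norm_dist {R : realType} {V : lmodType R} {nu : V -> R} (x y : V) :
  is_norm nu -> `|nu x - nu y| <= nu (x - y).
Proof.
move=> nunu; have [nuD _ _] := nunu.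
rewrite ler_distl lerBlDr.
have := nuD (x - y) y; have := nuD (y - x) x; rewrite !subrK => yx xy.
by rewrite (addrC (nu y)) xy andbT addrC -(is_normN (x - y)) // opprB.
Qed.

Lemma ler_entry_mx_norm {R : realType} {m n : nat} (X : 'M[R]_(m, n)) i j :
  `|X i j| <= `|X|.
Proof.
by rewrite [leRHS]/Num.Def.normr /= mx_normrE
  (le_bigmax _ (fun ij => `|X ij.1 ij.2|) (i, j)).
Qed.

(** Expand [X] in the matrices [delta_mx i j] and use the triangle inequality; adding 1 to the sum
    of their norms keeps [K] positive even when there are no entries. *)
Lemma is_norm_le_entries {R : realType} {m n : nat} {nu : 'M[R]_(m, n) -> R} :
  is_norm nu -> exists2 K, 0 < K &
  forall (X : 'M[R]_(m, n)) (c : R), 0 <= c -> (forall i j, `|X i j| <= c) -> nu X <= K * c.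
Proof.
move=> nunu; have [nuD nuZ _] := nunu.
have nu_sum (I : Type) (s : seq I) (F : I -> 'M[R]_(m, n)) :
    nu (\sum_(i <- s) F i) <= \sum_(i <- s) nu (F i).
  elim/big_rec2: _ => [|i y x _ le]; first by rewrite is_norm0.
  by rewrite (le_trans (nuD _ _))// lerD2l.
pose S := \sum_i \sum_j nu (delta_mx i j).
have S0 : 0 <= S by do 2 (apply: sumr_ge0 => ? _); exact: is_norm_ge0.
exists (S + 1) => [|X c c0 Xc]; first by rewrite ltr_wpDl.
apply: (@le_trans _ _ (S * c)); last by rewrite ler_wpM2r// lerDl.
rewrite {1}(matrix_sum_delta X) (le_trans (nu_sum _ _ _))// mulr_suml.
apply: ler_sum => i _; rewrite (le_trans (nu_sum _ _ _))// mulr_suml.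
apply: ler_sum => j _; rewrite nuZ mulrC ler_wpM2l// is_norm_ge0//.
Qed.

Lemma is_norm_continuous {R : realType} {m n : nat} {nu : 'M[R]_(m, n) -> R} :
  is_norm nu -> continuous nu.
Proof.
move=> nunu x; have [K K0 nuK] := is_norm_le_entries nunu.
apply/(@cvgrPdist_lt _ R^o _ (nbhs x)) => e e0; near_simpl; apply/nbhs_normP.
exists (e / K) => [|y /= xy]; first by rewrite /= divr_gt0.
rewrite (le_lt_trans (is_norm_dist _ _ nunu))//.
rewrite (le_lt_trans (nuK _ `|x - y| _ _))//; first exact: ler_entry_mx_norm.
by rewrite mulrC -ltr_pdivlMr.
Qed.

(** The continuous [nu] attains its minimum on the compact unit sphere of the sup norm; this minimum
    is positive by definiteness and serves as [c]. *)
Lemma rV_norm_le_is_norm {R : realType} {n : nat} {nu : 'rV[R]_n -> R} :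
  is_norm nu -> exists2 c, 0 < c & forall x : 'rV[R]_n, c * `|x| <= nu x.
Proof.
move=> nunu; have [_ nuZ nu0] := nunu.
pose S : set 'rV[R]_n := [set x | `|x| = 1].
have scaleS x : x != 0 -> S (`|x|^-1 *: x).
  by move=> x0; rewrite /S/= normrZ normfV normr_id mulVf ?normr_eq0.
(* An empty sphere means that 0 is the only vector, so any [c] will do. *)
have [S0|/set0P S0] := eqVneq S set0.
  exists 1 => // x; have [->|x0] := eqVneq x 0.
    by rewrite normr0 mulr0 is_norm0.
  by have := scaleS _ x0; rewrite S0.
have cS : compact S.
  apply: bounded_closed_compact.
    by exists 1; split => // M M1 x /= ->; exact: ltW.
  rewrite (_ : S = (fun x : 'rV[R]_n => `|x|) @^-1` [set 1])//; apply: preimage_closed.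
    by move=> x _; exact: norm_continuous.
  exact: closed_eq.
have cnu : {within S, continuous nu}.
  by apply: continuous_subspaceT; exact: is_norm_continuous.
have [x0 /[!inE] Sx0 minx0] := EVT_min_rV S0 cS cnu.
exists (nu x0) => [|x].
  rewrite lt_neqAle is_norm_ge0// andbT eq_sym; apply/eqP => /nu0 x00.
  by move: Sx0; rewrite /S/= x00 normr0 => /eqP; rewrite eq_sym oner_eq0.
have [->|xn0] := eqVneq x 0; first by rewrite normr0 mulr0 is_norm0.
have := minx0 _ (mem_set (scaleS _ xn0)).
by rewrite nuZ normfV normr_id mulrC ler_pdivlMr ?normr_gt0.
Qed.

Lemma entries_le_is_norm {R : realType} {m n : nat} {nu : 'M[R]_(m, n) -> R} :
  is_norm nu -> exists2 K, 0 < K &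
  forall (X : 'M[R]_(m, n)) i j, `|X i j| <= K * nu X.
Proof.
move=> [nuD nuZ nu0].
have nunu : is_norm (nu \o vec_mx).
  split => [x y|a x|x] /=; first by rewrite linearD.
  - by rewrite linearZ nuZ.
  - by move/nu0 => x0; rewrite -(vec_mxK x) x0 linear0.
have [c c0 le_nu] := rV_norm_le_is_norm nunu.
exists c^-1 => [|X i j]; first by rewrite invr_gt0.
rewrite ler_pdivlMl// -(mxvecE X) (le_trans _ (_ : c * `|mxvec X| <= _))//.
  by rewrite ler_wpM2l ?(ltW c0) ?ler_entry_mx_norm.
by have := le_nu (mxvec X); rewrite /= mxvecK.
Qed.

(** * Cylinders, splicing and limits of sequences *)

Definition agree {T : Type} (n : nat) (u v : nat -> T) : Prop :=
  forall k, (k < n)%N -> u k = v k.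

Definition splice {T : Type} (m : nat) (u v : nat -> T) : nat -> T :=
  fun k => if (k < m)%N then u k else v (k - m)%N.

Lemma agree_sym {T : Type} n (u v : nat -> T) : agree n u v -> agree n v u.
Proof. by move=> uv k /uv. Qed.

Lemma agree_trans {T : Type} n (u v w : nat -> T) :
  agree n u v -> agree n v w -> agree n u w.
Proof. by move=> uv vw k kn; rewrite uv// vw. Qed.

Lemma agreeW {T : Type} {m n} {u v : nat -> T} :
  (m <= n)%N -> agree n u v -> agree m u v.
Proof. by move=> mn uv k km; apply: uv; exact: leq_trans km mn. Qed.

Lemma agree_splice {T : Type} m (u v : nat -> T) : agree m (splice m u v) u.
Proof. by move=> k km; rewrite /splice km. Qed.

Lemma splice_shift {T : Type} m (u v : nat -> T) k :
  splice m u v (m + k)%N = v k.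
Proof. by rewrite /splice ltnNge leq_addr /= addKn. Qed.

Lemma splice_in {T : Type} {S : set T} m u v :
  seqs_in S u -> seqs_in S v -> seqs_in S (splice m u v).
Proof. by move=> uS vS k; rewrite /splice; case: ifP. Qed.

(** The term of index [k] no longer changes from stage [k.+1] on, since [k < n k.+1]; hence the
    shift in the diagonal. *)
Lemma agree_diagonal {T : Type} (u : nat -> nat -> T) (n : nat -> nat) :
  (forall i, (i <= n i)%N) -> (forall i, (n i <= n i.+1)%N) ->
  (forall i, agree (n i) (u i) (u i.+1)) ->
  forall i, agree (n i) (fun k => u k.+1 k) (u i).
Proof.
move=> ni nS uS.
have mono i j : (i <= j)%N -> agree (n i) (u j) (u i).
  elim: j => [|j IH]; first by rewrite leqn0 => /eqP->.
  rewrite leq_eqVlt ltnS => /predU1P[->//|ij].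
  apply: agree_trans (IH ij); apply: agree_sym; apply: agreeW (uS j).
  by apply: (homo_leq leqnn leq_trans nS).
move=> i k kn; have [ik|ki] := leqP i k.+1; first by rewrite (mono i k.+1).
by rewrite -(mono k.+1 i)// ?(ltnW ki)// ni.
Qed.

(** Dependent choice, with an invariant and a step relation that vary with the stage. *)
Lemma exists_chain {X : Type} (I : nat -> X -> Prop) (E : nat -> X -> X -> Prop)
    (x0 : X) :
  I 0%N x0 -> (forall n x, I n x -> exists2 y, I n.+1 y & E n x y) ->
  exists f, forall n, I n (f n) /\ E n (f n) (f n.+1).
Proof.
move=> I0 step.
have /choice[g gP] : forall p : nat * X, exists y,
    I p.1 p.2 -> I p.1.+1 y /\ E p.1 p.2 y.
  move=> [n x] /=; have [/step[y Iy Exy]|nI] := pselect (I n x).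
    by exists y.
  by exists x.
pose fix f n := if n is k.+1 then g (k, f k) else x0.
have If n : I n (f n) by elim: n => //= n /(gP (n, _))[].
by exists f => n; split => //; have [] := gP (n, f n) (If n).
Qed.

(* The Baire category theorem in the space of sequences in [S], for the closed
   sets [F c = {u | forall n, Q c n u}]. *)
Lemma closed_cover_has_cylinder {T : Type} (S : set T)
    (Q : nat -> nat -> (nat -> T) -> Prop) :
  S !=set0 ->
  (forall c n u v, agree n u v -> Q c n u -> Q c n v) ->
  (forall u, seqs_in S u -> exists c, forall n, Q c n u) ->
  exists c m w, seqs_in S w /\
    forall u, seqs_in S u -> agree m u w -> forall n, Q c n u.
Proof.
move=> [x0 Sx0] Qagree cover; apply: contrapT => no_cylinder.
(* A pair [(w, m)] stands for the cylinder of the first [m] terms of [w]. Stage [i] shrinks it to a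
   cylinder disjoint from [F i]. *)
have [|c [w m] /= [wS cm]|f fP] := @exists_chain ((nat -> T) * nat)
    (fun i p => seqs_in S p.1 /\ (i <= p.2)%N)
    (fun i p q => [/\ (p.2 <= q.2)%N, agree p.2 p.1 q.1
       & exists2 n, (n <= q.2)%N & ~ Q i n q.1]) (fun=> x0, 0%N).
- by split.
- have [u [uS uw [n nQ]]] : exists u,
      [/\ seqs_in S u, agree m u w & exists n, ~ Q c n u].
    apply: contrapT => no_u; apply: no_cylinder; exists c, m, w.
    split => // u uS uw n.
    by apply: contrapT => nQ; apply: no_u; exists u; split => //; exists n.
  (* Length [n] makes the failure of [Q c n] visible on the cylinder; [m.+1] makes the lengths grow
     without bound. *)
  exists (u, maxn n m.+1) => /=; split => //.
  + by rewrite (leq_trans _ (leq_maxr _ _)).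
  + by rewrite (leq_trans _ (leq_maxr _ _)).
  + exact: agree_sym.
  + by exists n; rewrite ?leq_maxl.
pose a k := (f k.+1).1 k.
have aS : seqs_in S a by move=> k; have [[+ _] _] := fP k.+1; exact.
(* The limit [a] lies in every cylinder, hence in the one that avoids [F c]. *)
have [c /(_ _)Qa] := cover _ aS.
have [_ [_ _ [n nm nQ]]] := fP c; apply: nQ.
apply: Qagree (Qa n); apply: agreeW nm _.
by apply: (agree_diagonal (fst \o f) (snd \o f) _ _ _ c.+1) => i /=;
  have [[_ le_i] []] := fP i.
Qed.

(** * Compactness over a finite alphabet *)

Lemma finite_set_bound {T : eqType} (S : set T) (P : T -> nat -> Prop) :
  finite_set S -> (forall x m n, (m <= n)%N -> P x m -> P x n) ->
  (forall x, S x -> exists n, P x n) -> exists n, forall x, S x -> P x n.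
Proof.
move=> /finite_seqP[s ->] Pmono; elim: s => [|x s IH] ex; first by exists 0%N.
have [n nP] := ex x (mem_head _ _).
have [y ys|m mP] := IH; first by apply: ex; rewrite /= inE ys orbT.
exists (maxn n m) => y; rewrite /= inE => /predU1P[->|ys].
  by apply: Pmono nP; rewrite leq_maxl.
by apply: Pmono (mP _ ys); rewrite leq_maxr.
Qed.

(** Grow a prefix letter by letter, keeping it extendible to solutions of every finite depth;
    finiteness of [S] provides the next letter. *)
Lemma konig {T : eqType} (S : set T) (P : nat -> (nat -> T) -> Prop) :
  finite_set S ->
  (forall n u v, agree n u v -> P n u -> P n v) ->
  (forall n, exists2 u, seqs_in S u & forall k, (k <= n)%N -> P k u) ->
  exists2 u, seqs_in S u & forall k, P k u.
Proof.
move=> finS Pagree ex.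
pose extendible m w := forall n, exists u,
  [/\ seqs_in S u, agree m u w & forall k, (k <= n)%N -> P k u].
have [u0 _ _] := ex 0%N.
have [n|m w wext|f fP] := @exists_chain (nat -> T) extendible agree u0.
- by have [u uS uP] := ex n; exists u; split.
- have [y yext] : exists y, forall n, exists u,
      [/\ seqs_in S u, agree m u w, u m = y & forall k, (k <= n)%N -> P k u].
    apply: contrapT => no_y.
    (* If every letter failed at some depth, all letters of [S] would fail at a common depth [n],
       yet [w] has an extension [u] of depth [n], with letter [u m]. *)
    have [|y _|n nP] := finite_set_bound S
      (fun y n => ~ exists u,
      [/\ seqs_in S u, agree m u w, u m = y & forall k, (k <= n)%N -> P k u]) finS.
    + move=> y i n le_in nex [u [uS uw uy uP]]; apply: nex; exists u; split => //.
      by move=> k ki; apply: uP; exact: leq_trans ki le_in.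
    + by apply/existsNP => yP; apply: no_y; exists y.
    + by have [u [uS uw uP]] := wext n; apply: (nP _ (uS m)); exists u.
  (* Only the value [y] at index [m] matters; the later terms are filler. *)
  exists (splice m w (fun=> y)); last exact/agree_sym/agree_splice.
  move=> n; have [u [uS uw uy uP]] := yext n; exists u; split => // k.
  rewrite ltnS leq_eqVlt /splice => /predU1P[->|km]; first by rewrite ltnn.
  by rewrite km uw.
pose a k := f k.+1 k.
have af i : agree i a (f i).
  by apply: (agree_diagonal f id) => // j; have [] := fP j.
exists a => k.
  have [/(_ 0%N)[u [uS uf _]] _] := fP k.+1.
  by rewrite /a -uf.
have [/(_ k)[u [uS uf uP]] _] := fP k.
apply: Pagree (uP _ (leqnn k)).
by apply: agree_trans uf _; exact/agree_sym/af.
Qed.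

(** * Alternating products and row sums of nonnegative matrices *)

Lemma altprod_agree {R : realType} {N M : nat} {A A' : nat -> 'M[R]_(N, M)}
    {B B' : nat -> 'M[R]_(M, N)} {n} :
  agree n A A' -> agree n B B' -> altprod A B n = altprod A' B' n.
Proof.
elim: n => //= n IH AA' BB'; rewrite AA'// BB'// IH// => k kn.
- by rewrite AA'// ltnW.
- by rewrite BB'// ltnW.
Qed.

Lemma altprodD {R : realType} {N M : nat} (A : nat -> 'M[R]_(N, M))
    (B : nat -> 'M[R]_(M, N)) m n :
  altprod A B (m + n) =
  altprod (fun k => A (m + k)%N) (fun k => B (m + k)%N) n *m altprod A B m.
Proof. by elim: n => [|n IH]; rewrite ?addn0 ?mul1mx// addnS /= IH !mulmxA. Qed.

Lemma nonneg_mxM {R : realType} {m n p : nat} {X : 'M[R]_(m, n)} {Y : 'M[R]_(n, p)} :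
  nonneg_mx X -> nonneg_mx Y -> nonneg_mx (X *m Y).
Proof. by move=> X0 Y0 i j; rewrite mxE sumr_ge0// => k _; rewrite mulr_ge0. Qed.

Lemma row_sum_mulmx {R : realType} {m n p : nat} (X : 'M[R]_(m, n)) (Y : 'M[R]_(n, p)) i :
  \sum_j (X *m Y) i j = \sum_k X i k * \sum_j Y k j.
Proof.
under eq_bigr do rewrite mxE.
by rewrite exchange_big /=; apply: eq_bigr => k _; rewrite mulr_sumr.
Qed.

Lemma row_sum_mulmx_ge {R : realType} {m n p : nat} {X : 'M[R]_(m, n)}
    {Y : 'M[R]_(n, p)} {b : R} i :
  nonneg_mx X -> (forall k, b <= \sum_j Y k j) ->
  (\sum_k X i k) * b <= \sum_j (X *m Y) i j.
Proof.
by move=> X0 Yb; rewrite row_sum_mulmx mulr_suml ler_sum// => k _; rewrite ler_wpM2l.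
Qed.

Lemma row_sums_lower_bound {R : realType} {m n : nat} {S : set 'M[R]_(m, n)} :
  finite_set S -> (forall X, S X -> pos_row_sums X) ->
  exists2 d : R, 0 < d & forall X, S X -> forall i, d <= \sum_j X i j.
Proof.
move=> /finite_seqP[s ->]; elim: s => [|X s IH] pos; first by exists 1.
have [Y Ys|d d0 dP] := IH; first by apply: pos; rewrite /= inE Ys orbT.
(* Starting the minimum at [d] keeps the bound valid for the matrices of [s]. *)
pose e := \big[Num.min/d]_i \sum_j X i j.
have e0 : 0 < e by apply/bigmin_gtP; split => // i _; apply: pos; rewrite /= mem_head.
exists e => // Y; rewrite /= inE => /predU1P[->|Ys] i; first exact: bigmin_le.
by rewrite (le_trans _ (dP _ Ys i))// bigmin_le_id.
Qed.

Lemma nonneg_altprod {R : realType} {N M : nat} {A : nat -> 'M[R]_(N, M)}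
    {B : nat -> 'M[R]_(M, N)} n :
  (forall k, nonneg_mx (A k)) -> (forall k, nonneg_mx (B k)) ->
  nonneg_mx (altprod A B n).
Proof.
move=> A0 B0; elim: n => [|n IH] /=; last by do 2! apply: nonneg_mxM => //.
by move=> i j; rewrite mxE ler0n.
Qed.

(** Left multiplication by a pair [A n *m B n] scales a lower bound on all row sums by at least
    [a * b]. *)
Lemma row_sum_altprod_ge {R : realType} {N M : nat} {A : nat -> 'M[R]_(N, M)}
    {B : nat -> 'M[R]_(M, N)} {a b : R} n i :
  (forall k, nonneg_mx (A k)) -> (forall k, nonneg_mx (B k)) ->
  0 <= a -> 0 <= b ->
  (forall k i, a <= \sum_j A k i j) -> (forall k i, b <= \sum_j B k i j) ->
  (a * b) ^+ n <= \sum_j altprod A B n i j.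
Proof.
move=> A0 B0 a0 b0 Aa Bb; elim: n i => [|n IH] i /=.
  by rewrite (bigD1 i)//= mxE eqxx lerDl sumr_ge0// => j _; rewrite mxE ler0n.
rewrite (le_trans _ (row_sum_mulmx_ge i _ IH))//; last exact: nonneg_mxM.
rewrite exprS ler_wpM2r ?exprn_ge0 ?mulr_ge0//.
rewrite (le_trans _ (row_sum_mulmx_ge i (A0 n) (Bb n)))//.
by rewrite ler_wpM2r.
Qed.

(** An entry of [X] is at most its row sum, and [d] times that is at most a row sum of [X *m Y],
    which has [p] terms bounded by [c]. *)
Lemma entry_le_mulmx {R : realType} {m n p : nat} {X : 'M[R]_(m, n)}
    {Y : 'M[R]_(n, p)} {c d : R} :
  nonneg_mx X -> 0 < d -> (forall k, d <= \sum_j Y k j) ->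
  (forall i j, (X *m Y) i j <= c) -> forall i k, X i k <= p%:R * c / d.
Proof.
move=> X0 d0 Yd XYc i k; rewrite ler_pdivlMr//.
rewrite (@le_trans _ _ ((\sum_k X i k) * d))//.
  by rewrite ler_wpM2r ?(ltW d0)// (bigD1 k)//= lerDl sumr_ge0.
rewrite (le_trans (row_sum_mulmx_ge i X0 Yd))//.
rewrite (le_trans (ler_sum _ (fun j _ => XYc i j)))//.
by rewrite sumr_const card_ord mulr_natl.
Qed.

Theorem theorem2 (R : realType) (N M : nat) (hN : (1 <= N)%N) (hM : (1 <= M)%N)
  (nu : 'M[R]_N -> R) (hnu : is_norm nu)
  (AA : set 'M[R]_(N, M)) (BB : set 'M[R]_(M, N))
  (finA : finite_set AA) (finB : finite_set BB)
  (nonnegA : forall A, AA A -> nonneg_mx A)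
  (nonnegB : forall B, BB B -> nonneg_mx B)
  (rowsA : forall A, AA A -> pos_row_sums A)
  (rowsB : forall B, BB B -> pos_row_sums B)
  (bndA : forall A : nat -> 'M[R]_(N, M), seqs_in AA A -> right_bounded nu BB A) :
  exists2 C : R, 0 < C &
    forall A : nat -> 'M[R]_(N, M), seqs_in AA A ->
    exists2 B : nat -> 'M[R]_(M, N), seqs_in BB B &
      forall n, (0 < n)%N -> nu (altprod A B n) <= C.
Proof.
have [[A0 AA0]|noA] := pselect (AA !=set0); last first.
  by exists 1 => // A AAA; case: noA; exists (A 0%N); exact: AAA.
(* Natural bounds make the cover countable. Letting [B] depend on [n] makes [Q c n] a condition on
   the first [n] terms of [A] only. *)
pose Q (c n : nat) (A : nat -> 'M[R]_(N, M)) := exists2 B, seqs_in BB B &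
  forall k, (0 < k <= n)%N -> nu (altprod A B k) <= c%:R.
have [|c n u v uv [B BBB Bc]|A AAA|c [m [w [AAw cylinder]]]] :=
    @closed_cover_has_cylinder _ AA Q.
- by exists A0.
- exists B => // k /andP[k0 kn].
  rewrite -(altprod_agree (agreeW kn uv) (fun=> fun=> erefl)).
  by rewrite Bc ?k0.
- have [B [C [BBB BC]]] := bndA _ AAA.
  exists (Num.bound `|C|) => n; exists B => // k /andP[k0 _].
  rewrite (le_trans (BC _ k0))// (le_trans (ler_norm _))//.
  by apply/ltW; exact: archi_boundP.
have [a a0 aA] := row_sums_lower_bound finA rowsA.
have [b b0 bB] := row_sums_lower_bound finB rowsB.
have [K K0 nuK] := is_norm_le_entries hnu.
have [L L0 Lnu] := entries_le_is_norm hnu.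
(* [d] bounds the row sums of the initial factor from below. [L * c%:R] bounds the entries of the
   whole product, so [c'] bounds those of the factor coming from [A], and [K * c'] bounds its
   norm. *)
pose d := (a * b) ^+ m; have d0 : 0 < d by rewrite exprn_gt0 ?mulr_gt0.
pose c' := N%:R * (L * c%:R) / d.
have c'0 : 0 <= c' by rewrite divr_ge0 ?(ltW d0)// mulr_ge0// mulr_ge0// ltW.
exists (K * c' + 1) => [|A AAA]; first by rewrite ltr_wpDl// mulr_ge0// ltW.
suff [B BBB BC] : exists2 B, seqs_in BB B &
    forall n, (0 < n)%N -> nu (altprod A B n) <= K * c'.
  by exists B => // n n0; rewrite (le_trans (BC n n0))// lerDl.
apply: (konig BB (fun n B => (0 < n)%N -> nu (altprod A B n) <= K * c')) => //.
  by move=> n u v uv; rewrite (altprod_agree (fun=> fun=> erefl) uv).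
move=> n; have wA_in := splice_in m _ _ AAw AAA.
(* Length [m + n] leaves [n] pairs after the word; the required [B] is the tail from index [m]
   on. *)
have [B BBB Bc] := cylinder _ wA_in (agree_splice m w A) (m + n)%N.
exists (fun k => B (m + k)%N) => [k|k kn k0]; first exact: BBB.
apply: nuK => // i j.
have tail0 : nonneg_mx (altprod A (fun k => B (m + k)%N) k).
  by apply: nonneg_altprod => l; [exact/nonnegA/AAA | exact/nonnegB/BBB].
rewrite ger0_norm//; move: i j; apply: (entry_le_mulmx tail0 d0).
  move=> i; apply: row_sum_altprod_ge (ltW a0) (ltW b0) _ _ => l.
  + exact/nonnegA/wA_in.
  + exact/nonnegB/BBB.
  + exact/aA/wA_in.
  + exact/bB/BBB.
move=> i j.
(* Cut the product of length [m + k] after the first [m] pairs; by [splice_shift] the later factor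
   is built from [A] itself. *)
have := Bc (m + k)%N; rewrite addn_gt0 k0 orbT leq_add2l kn => /(_ isT).
rewrite altprodD (altprod_agree (A' := A) (fun l _ => splice_shift m w A l)
  (fun=> fun=> erefl)) => nu_le.
by rewrite (le_trans (ler_norm _))// (le_trans (Lnu _ _ _))// ler_wpM2l// ltW.
Qed.
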